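(* Let $V$ be a finite set of $n$ variables and let $\mathcal{B}$ be a Sperner family of nonempty proper subsets of $V$ with $\bigcup_{B\in\mathcal{B}}B=V$ and $\bigcap_{B\in\mathcal{B}}B=\emptyset$. Let $k$ be an upper bound on the sizes of the sets in $\mathcal{B}$. There is a polynomial-time algorithm that, given $\mathcal{B}$, outputs a pure Horn CNF $\Phi$ representing the key Horn function $h_{\mathcal{B}}$ such that $$|\Phi|_*\le \min\{\lceil\log n\rceil+1,\ \lceil\log k\rceil+2,\ k\}\cdot OPT_*(\mathcal{B})\qquad\text{for } *\in\{C,BC\}.$$
   Context: A pure Horn clause $B\rightarrow v$, with $\emptyset\neq B\subseteq V$ and $v\in V\setminus B$, is the clause $v\vee\bigvee_{u\in B}\overline{u}$; $B$ is its body and $v$ its head. For $H\subseteq V\setminus B$, $B\rightarrow H$ abbreviates $\bigwedge_{v\in H}B\rightarrow v$. A pure Horn CNF is a conjunction of pure Horn clauses; grouping clauses by body, it is written $\Phi=\bigwedge_{i=1}^{r}B_i\rightarrow H_i$ with distinct bodies $B_i$ and nonempty $H_i$. Size measures: $|\Phi|_C=\sum_{i}|H_i|$ (number of clauses) and $|\Phi|_{BC}=\sum_i(|H_i|+1)$ (number of bodies plus clauses). For a family $\mathcal{B}$ of nonempty proper subsets of $V$, the key Horn function $h_{\mathcal{B}}$ is the Boolean function represented by $\bigwedge_{B\in\mathcal{B}}B\rightarrow(V\setminus B)$. A representation of $h_{\mathcal{B}}$ is any pure Horn CNF logically equivalent to it, and $OPT_*(\mathcal{B})$ is the minimum of $|\Phi|_*$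 over all representations $\Phi$ of $h_{\mathcal{B}}$. Sperner means no member of $\mathcal{B}$ is a proper subset of another. $\log$ is base $2$. *)

(* Defs.v *)
From mathcomp Require Import all_boot.
Set Implicit Arguments.
Unset Strict Implicit.
Unset Printing Implicit Defensive.

(** * Pure Horn CNFs and key Horn functions *)

Section Horn.
Variable V : finType.

Definition assignment := {ffun V -> bool}.

Definition horn_clause (B : {set V}) (v : V) (x : assignment) : bool :=
  x v || [exists u in B, ~~ x u].

(* A CNF grouped by body: the pair (B, H) stands for the conjunction of the
   clauses B -> v, v in H. *)
Definition cnf := {set {set V} * {set V}}.

Definition pure_horn (Phi : cnf) : bool :=
  [forall c in Phi, [&& c.1 != set0, c.2 != set0 & c.2 \subset ~: c.1]]
  && [forall c in Phi, forall c' in Phi, (c.1 == c'.1) ==> (c == c')].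

Definition cnf_val (Phi : cnf) (x : assignment) : bool :=
  [forall c in Phi, forall v in c.2, horn_clause c.1 v x].

Definition key_cnf (BB : {set {set V}}) : cnf := [set (B, ~: B) | B in BB].

Definition key_horn (BB : {set {set V}}) : assignment -> bool :=
  cnf_val (key_cnf BB).

Definition represents (Phi : cnf) (BB : {set {set V}}) : bool :=
  pure_horn Phi && [forall x, cnf_val Phi x == key_horn BB x].

Definition size_C (Phi : cnf) : nat := \sum_(c in Phi) #|c.2|.

Definition size_BC (Phi : cnf) : nat := \sum_(c in Phi) #|c.2|.+1.

(* [key_cnf BB] only serves as the default value of [arg min]; it is itself a
   representation as soon as the members of BB are nonempty and proper, and
   then this is a genuine minimum, see [OPT_attained] and [OPT_le]. *)
Definition OPT (size : cnf -> nat) (BB : {set {set V}}) : nat :=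
  size [arg min_(Phi < key_cnf BB | represents Phi BB) size Phi].

Definition nonempty_proper (BB : {set {set V}}) : Prop :=
  forall B, B \in BB -> B != set0 /\ B \proper [set: V].

Definition sperner (BB : {set {set V}}) : Prop :=
  forall B B', B \in BB -> B' \in BB -> ~~ (B \proper B').

Lemma key_cnf_represents BB : nonempty_proper BB -> represents (key_cnf BB) BB.
Proof.
move=> BBP; apply/andP; split; last by apply/forallP => x.
apply/andP; split.
  apply/forall_inP => _ /imsetP[B /BBP[B0 BT] ->] /=.
  rewrite B0 subxx andbT /= -setCT (inj_eq (can_inj setCK)).
  by rewrite -properT.
apply/forall_inP => _ /imsetP[B _ ->].
apply/forall_inP => _ /imsetP[B' _ ->] /=.
by apply/implyP => /eqP->.
Qed.

Lemma OPT_attained size BB : nonempty_proper BB ->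
  exists2 Phi, represents Phi BB & size Phi = OPT size BB.
Proof.
move=> BBP; rewrite /OPT; case: arg_minnP => [|Phi PhiP _].
  exact: key_cnf_represents.
by exists Phi.
Qed.

Lemma OPT_le size BB Phi : nonempty_proper BB ->
  represents Phi BB -> OPT size BB <= size Phi.
Proof.
move=> BBP PhiP; rewrite /OPT; case: arg_minnP => [|Psi _]; last exact.
exact: key_cnf_represents.
Qed.

End Horn.

(** * Model of computation

   First-order recursive programs over binary trees, in the style of Jones'
   languages WHILE and F, with call by value.  Reading a variable copies its
   value and costs the size of that value; every other step costs 1.  Hence
   the size of a value never exceeds the cost of producing it, and an
   evaluation of cost t can be simulated by a Turing machine in time
   polynomial in t and in the size of the input, and conversely. *)

Inductive tree := Leaf | Node of tree & tree.

Fixpoint tree_size (t : tree) : nat :=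
  if t is Node l r then (tree_size l + tree_size r).+1 else 1.

Definition hd (t : tree) : tree := if t is Node l _ then l else Leaf.
Definition tl (t : tree) : tree := if t is Node _ r then r else Leaf.

(* Variables are positions in the environment.  [If] tests for a [Node].
   [Call f es] calls the f-th function of the program; its body is evaluated
   in the environment consisting of the values of the arguments [es]. *)
Inductive expr :=
  | Var of nat
  | ELeaf
  | ENode of expr & expr
  | Hd of expr
  | Tl of expr
  | If of expr & expr & expr
  | Let of expr & expr
  | Call of nat & seq expr.

Definition program := seq expr.

(* [eval P env e v t]: in the environment [env], [e] has value [v], at cost [t]. *)
Inductive eval (P : program) : seq tree -> expr -> tree -> nat -> Prop :=
  | eval_Var env i :
      eval P env (Var i) (nth Leaf env i) (tree_size (nth Leaf env i))
  | eval_Leaf env :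
      eval P env ELeaf Leaf 1
  | eval_Node env e1 e2 v1 v2 t1 t2 :
      eval P env e1 v1 t1 -> eval P env e2 v2 t2 ->
      eval P env (ENode e1 e2) (Node v1 v2) (t1 + t2).+1
  | eval_Hd env e v t :
      eval P env e v t -> eval P env (Hd e) (hd v) t.+1
  | eval_Tl env e v t :
      eval P env e v t -> eval P env (Tl e) (tl v) t.+1
  | eval_If_Node env e e1 e2 l r v t t1 :
      eval P env e (Node l r) t -> eval P env e1 v t1 ->
      eval P env (If e e1 e2) v (t + t1).+1
  | eval_If_Leaf env e e1 e2 v t t2 :
      eval P env e Leaf t -> eval P env e2 v t2 ->
      eval P env (If e e1 e2) v (t + t2).+1
  | eval_Let env e1 e2 v1 v2 t1 t2 :
      eval P env e1 v1 t1 -> eval P (v1 :: env) e2 v2 t2 ->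
      eval P env (Let e1 e2) v2 (t1 + t2).+1
  | eval_Call env f es vs v t t' :
      evals P env es vs t -> eval P vs (nth ELeaf P f) v t' ->
      eval P env (Call f es) v (t + t').+1
with evals (P : program) : seq tree -> seq expr -> seq tree -> nat -> Prop :=
  | evals_nil env :
      evals P env [::] [::] 0
  | evals_cons env e es v vs t t' :
      eval P env e v t -> evals P env es vs t' ->
      evals P env (e :: es) (v :: vs) (t + t').

(* The main function is the first one. *)
Definition run (P : program) (input output : tree) (t : nat) : Prop :=
  eval P [:: input] (nth ELeaf P 0) output t.

(** * Encodings

   A set of variables is its characteristic vector, so that a family is the
   list of rows of its incidence matrix.  As the family covers V, the size of
   this encoding is polynomially related to the total size of its members. *)

Definition enc_seq (T : Type) (enc : T -> tree) (s : seq T) : tree :=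
  foldr (fun x t => Node (enc x) t) Leaf s.

Definition enc_bool (b : bool) : tree := if b then Node Leaf Leaf else Leaf.

Definition enc_set (V : finType) (B : {set V}) : tree :=
  enc_seq enc_bool [seq v \in B | v <- enum V].

Definition enc_family (V : finType) (s : seq {set V}) : tree :=
  enc_seq (@enc_set V) s.

Definition enc_cnf (V : finType) (r : seq ({set V} * {set V})) : tree :=
  enc_seq (fun c => Node (enc_set c.1) (enc_set c.2)) r.

(* Main.v *)
Require Import Defs.
From mathcomp Require Import all_boot zify.
Set Implicit Arguments.
Unset Strict Implicit.
Unset Printing Implicit Defensive.

(* Give the members of BB the arc lengths |B' \ B|.  A greedy algorithm in the
   style of Boruvka builds an in-arborescence of BB: the members are divided
   into basins, each of which derives the root R it contains, and a shortest
   arc from a root R to a member B' of another basin becomes the clauses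
   R -> B' \ R, which merges the two basins.  The last root R0 finally gets the
   clauses R0 -> V \ R0.

   In any representation of size O, the clauses whose body contains members of
   a single basin must lead from its root to a member of another basin, so with
   p basins the next arc costs at most O / p; it also costs at most the minimum
   size K of a member.  Arcs added while the number of basins is halved
   cost at most O altogether; after t = log n or log k halvings of |BB| <= O
   basins the remaining arcs cost at most |BB| / 2^t * K, and n <= O pays for
   the last root.  The bodies of the output are exactly the members of BB, which are
   bodies of every representation, so the bound for C gives the one for BC.

   The bound k is smaller than these only if k <= 3.  When all members have at
   most 3 elements, the algorithm therefore puts them in cyclic order and
   outputs the clauses B_i -> B_(i+1) \ B_i. *)

(** * The program *)

Definition f_small := 1.
Definition f_ones := 2.
Definition f_le := 3.
Definition f_diff := 4.
Definition f_compl := 5.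
Definition f_cyc := 6.
Definition f_init := 7.
Definition f_better := 8.
Definition f_inner := 9.
Definition f_outer := 10.
Definition f_upd := 11.
Definition f_loop := 12.

Definition ETrue := ENode ELeaf ELeaf.

(* Each body is preceded by the name of the function and of its arguments
   [Var 0], [Var 1], ...; a basin structure [st] is a list of pairs
   (member, root of its basin), and [le] compares unary numbers. *)
Definition prog : program := [::
  (* main s *)
  If (Call f_small [:: Var 0])
     (Call f_cyc [:: Hd (Var 0); Var 0])
     (Call f_loop [:: Var 0; Call f_init [:: Var 0]]);
  (* small l *)
  If (Var 0)
     (If (Tl (Tl (Tl (Call f_ones [:: Hd (Var 0)])))) ELeaf
         (Call f_small [:: Tl (Var 0)]))
     ETrue;
  (* ones B *)
  If (Var 0)
     (If (Hd (Var 0)) (ENode ELeaf (Call f_ones [:: Tl (Var 0)]))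
         (Call f_ones [:: Tl (Var 0)]))
     ELeaf;
  (* le a b *)
  If (Var 0)
     (If (Var 1) (Call f_le [:: Tl (Var 0); Tl (Var 1)]) ELeaf)
     ETrue;
  (* diff A B *)
  If (Var 0)
     (ENode (If (Hd (Var 1)) ELeaf (Hd (Var 0)))
            (Call f_diff [:: Tl (Var 0); Tl (Var 1)]))
     ELeaf;
  (* compl A *)
  If (Var 0)
     (ENode (If (Hd (Var 0)) ELeaf ETrue) (Call f_compl [:: Tl (Var 0)]))
     ELeaf;
  (* cyc F l *)
  If (Var 1)
     (ENode
        (ENode (Hd (Var 1))
               (Call f_diff [:: If (Tl (Var 1)) (Hd (Tl (Var 1))) (Var 0);
                                Hd (Var 1)]))
        (Call f_cyc [:: Var 0; Tl (Var 1)]))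
     ELeaf;
  (* init l *)
  If (Var 0)
     (ENode (ENode (Hd (Var 0)) (Hd (Var 0))) (Call f_init [:: Tl (Var 0)]))
     ELeaf;
  (* better b c *)
  If (Var 0)
     (If (Call f_le [:: Call f_ones [:: Hd (Tl (Var 0))];
                        Call f_ones [:: Hd (Tl (Var 1))]])
         (Var 0) (Var 1))
     (Var 1);
  (* inner R st b *)
  If (Var 1)
     (Call f_inner
        [:: Var 0; Tl (Var 1);
            If (Call f_ones [:: Call f_diff [:: Var 0; Tl (Hd (Var 1))]])
               (Call f_better
                  [:: Var 2;
                      ENode (Var 0)
                            (ENode (Call f_diff [:: Hd (Hd (Var 1)); Var 0])
                                   (Tl (Hd (Var 1))))])
               (Var 2)])
     (Var 2);
  (* outer l st b *)
  If (Var 0)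
     (Call f_outer
        [:: Tl (Var 0); Var 1;
            Call f_inner [:: Tl (Hd (Var 0)); Var 1; Var 2]])
     (Var 2);
  (* upd R R' st *)
  If (Var 2)
     (ENode
        (ENode (Hd (Hd (Var 2)))
               (If (Call f_ones [:: Call f_diff [:: Var 0; Tl (Hd (Var 2))]])
                   (Tl (Hd (Var 2))) (Var 1)))
        (Call f_upd [:: Var 0; Var 1; Tl (Var 2)]))
     ELeaf;
  (* loop fuel st *)
  If (Var 0)
     (Let (Call f_outer [:: Var 1; Var 1; ELeaf])
        (If (Var 0)
           (ENode (ENode (Hd (Var 0)) (Hd (Tl (Var 0))))
              (Call f_loop
                 [:: Tl (Var 1);
                     Call f_upd [:: Hd (Var 0); Tl (Tl (Var 0)); Var 2]]))
           (ENode (ENode (Tl (Hd (Var 2)))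
                         (Call f_compl [:: Tl (Hd (Var 2))]))
                  ELeaf)))
     ELeaf].

(** * Evaluation with upper bounds on the cost *)

Definition ev env e v T := exists2 t, eval prog env e v t & t <= T.
Definition evl env es vs T := exists2 t, evals prog env es vs t & t <= T.
Definition call f vs v T := ev vs (nth ELeaf prog f) v T.

Lemma ev_le env e v T T' : ev env e v T -> T <= T' -> ev env e v T'.
Proof. by move=> [t evt le_t] le_T; exists t => //; apply: leq_trans le_T. Qed.

Lemma call_le f vs v T T' : call f vs v T -> T <= T' -> call f vs v T'.
Proof. exact: ev_le. Qed.

Lemma ev_var env i v : nth Leaf env i = v -> ev env (Var i) v (tree_size v).
Proof. by move=> <-; exists (tree_size (nth Leaf env i)) => //; constructor. Qed.

Lemma ev_leaf env : ev env ELeaf Leaf 1.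
Proof. by exists 1 => //; constructor. Qed.

Lemma ev_node env e1 e2 v1 v2 T1 T2 :
  ev env e1 v1 T1 -> ev env e2 v2 T2 ->
  ev env (ENode e1 e2) (Node v1 v2) (T1 + T2).+1.
Proof.
move=> [t1 ? ?] [t2 ? ?]; exists (t1 + t2).+1; first by constructor.
by rewrite ltnS leq_add.
Qed.

Lemma ev_hd env e v w T : ev env e v T -> hd v = w -> ev env (Hd e) w T.+1.
Proof. by move=> + <-; move=> [t ? ?]; exists t.+1 => //; constructor. Qed.

Lemma ev_tl env e v w T : ev env e v T -> tl v = w -> ev env (Tl e) w T.+1.
Proof. by move=> + <-; move=> [t ? ?]; exists t.+1 => //; constructor. Qed.

(** The match on [v0] lets one rule serve both constructors of [eval]: the branch is selected by
    computation once the value of the test is known. *)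
Lemma ev_if env e e1 e2 v0 v T0 T :
  ev env e v0 T0 -> ev env (if v0 is Node _ _ then e1 else e2) v T ->
  ev env (If e e1 e2) v (T0 + T).+1.
Proof.
move=> [t0 ev0 ?] [t evt ?]; exists (t0 + t).+1; last by rewrite ltnS leq_add.
case: v0 ev0 evt => [|l r] ev0 evt; first exact: eval_If_Leaf.
by apply: eval_If_Node; eassumption.
Qed.

Lemma ev_let env e1 e2 v1 v2 T1 T2 :
  ev env e1 v1 T1 -> ev (v1 :: env) e2 v2 T2 ->
  ev env (Let e1 e2) v2 (T1 + T2).+1.
Proof.
move=> [t1 ? ?] [t2 ? ?]; exists (t1 + t2).+1; last by rewrite ltnS leq_add.
by econstructor; eassumption.
Qed.

Lemma ev_call env f es vs v T1 T2 :
  evl env es vs T1 -> call f vs v T2 -> ev env (Call f es) v (T1 + T2).+1.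
Proof.
move=> [t1 ? ?] [t2 ? ?]; exists (t1 + t2).+1; last by rewrite ltnS leq_add.
by econstructor; eassumption.
Qed.

Lemma evl_nil env : evl env [::] [::] 0.
Proof. by exists 0 => //; constructor. Qed.

Lemma evl_cons env e es v vs T1 T2 :
  ev env e v T1 -> evl env es vs T2 -> evl env (e :: es) (v :: vs) (T1 + T2).
Proof.
move=> [t1 ? ?] [t2 ? ?]; exists (t1 + t2); last by rewrite leq_add.
by constructor.
Qed.


Lemma enc_cons T (enc : T -> tree) x l :
  enc_seq enc (x :: l) = Node (enc x) (enc_seq enc l).
Proof. by []. Qed.

Lemma tree_size_gt0 t : 0 < tree_size t.
Proof. by case: t. Qed.

Lemma size_enc_seq T (enc : T -> tree) l : size l < tree_size (enc_seq enc l).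
Proof. by elim: l => //= x l IHl; have := tree_size_gt0 (enc x); lia. Qed.

Arguments enc_seq : simpl never.

Ltac ev_step :=
  cbn [nth hd tl];
  lazymatch goal with
  | |- evl _ _ _ _ => first [apply: evl_nil | eapply evl_cons]
  | |- ev _ _ _ _ =>
    first [ eapply ev_call | eapply ev_var | apply: ev_leaf | eapply ev_node
          | eapply ev_hd | eapply ev_tl | eapply ev_if | eapply ev_let ]
  | |- _ = _ => reflexivity
  end.

(* Symbolic execution with the cost left open; [tac] closes the goals about called functions. What
   remains is to compare the accumulated cost with the claimed one. *)
Tactic Notation "ev_run" tactic3(tac) :=
  unfold call at 1; eapply ev_le; [repeat first [ev_step | tac] | ].

Fixpoint enc_nat n := if n is n'.+1 then Node Leaf (enc_nat n') else Leaf.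

Lemma tree_size_nat n : tree_size (enc_nat n) = n.*2.+1.
Proof. by elim: n => //= n ->; lia. Qed.

(** The pattern of all cost lemmas: each recursive call reads boundedly many values of size at most
    [N], and the bound on the tail is inherited from the whole list, so [N] stays fixed in the
    induction. *)
Lemma call_ones N (l : seq bool) :
  tree_size (enc_seq enc_bool l) <= N ->
  call f_ones [:: enc_seq enc_bool l] (enc_nat (count id l))
       ((size l).+1 * (20 * N)).
Proof.
elim: l => [|b l IHl] leN; first by ev_run fail; move: leN => /=; lia.
rewrite enc_cons /= in leN *; have {}IHl : _ := IHl _.
case: b leN => /= leN; ev_run (apply: IHl; lia); move: leN => /=; lia.
Qed.

Lemma call_le_nat N a b :
  tree_size (enc_nat a) <= N -> tree_size (enc_nat b) <= N ->
  call f_le [:: enc_nat a; enc_nat b] (enc_bool (a <= b)) (a.+1 * (20 * N)).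
Proof.
elim: a b => [|a IHa] [|b] /= leN leN'.
- by ev_run fail; rewrite /=; lia.
- by ev_run fail; rewrite /=; lia.
- by ev_run fail; rewrite /=; lia.
by ev_run (apply: IHa; lia); rewrite /=; lia.
Qed.

(** * Running times on encoded sets *)

Section Sets.
Variable V : finType.
Implicit Types (A B R : {set V}).

(** The list [l] is general for the sake of induction; [enc_set] is the case [l = enum V]. *)
Notation enc_row l A := (enc_seq enc_bool [seq v \in A | v <- l]).

Lemma call_diff_row N (l : seq V) A B :
  tree_size (enc_row l A) <= N -> tree_size (enc_row l B) <= N ->
  call f_diff [:: enc_row l A; enc_row l B] (enc_row l (A :\: B))
       ((size l).+1 * (20 * N)).
Proof.
elim: l => [|v l IHl] /= leA leB; first by ev_run fail; move: leA => /=; lia.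
rewrite !enc_cons /= in leA leB *.
rewrite in_setD; case: (v \in B) leB => /= leB;
  by ev_run (apply: IHl; lia); rewrite /=; lia.
Qed.

Lemma call_compl_row N (l : seq V) A :
  tree_size (enc_row l A) <= N ->
  call f_compl [:: enc_row l A] (enc_row l (~: A)) ((size l).+1 * (20 * N)).
Proof.
elim: l => [|v l IHl] /= leA; first by ev_run fail; move: leA => /=; lia.
rewrite !enc_cons /= in leA *.
rewrite in_setC; case: (v \in A) leA => /= leA;
  by ev_run (apply: IHl; lia); rewrite /=; lia.
Qed.

Lemma size_enc_set A : #|V| < tree_size (enc_set A).
Proof.
have := size_enc_seq enc_bool [seq v \in A | v <- enum V].
by rewrite size_map -cardE.
Qed.

Lemma enc_set_le A : tree_size (enc_set A) <= 4 * #|V| + 1.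
Proof.
rewrite /enc_set cardE; elim: (enum V) => //= v l IHl.
by case: (v \in A) => /=; lia.
Qed.

Lemma count_row A : count id [seq v \in A | v <- enum V] = #|A|.
Proof.
by rewrite count_map cardE enumT /enum_mem size_filter; apply: eq_count.
Qed.

(* [N] is to bound the size of every value that the program reads. *)
Variable N : nat.
Hypothesis set_leN : forall A, 5 * tree_size (enc_set A) <= N.

Let N_ge5 : 5 <= N.
Proof.
by have := set_leN set0; have := tree_size_gt0 (enc_set (set0 : {set V})); lia.
Qed.

Let V_ltN : #|V| < N.
Proof. by have := set_leN set0; have := size_enc_set set0; lia. Qed.

(** [lia] treats the powers of [N] as atoms; this fact and its analogues below let it compare
    them. *)
Let leN2 : N <= N * N. Proof. by rewrite leq_pmulr; lia. Qed.

Lemma call_ones_set A :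
  call f_ones [:: enc_set A] (enc_nat #|A|) (20 * (N * N)).
Proof.
rewrite -count_row; apply: call_le.
  by apply: (@call_ones N); have := set_leN A; rewrite /enc_set; lia.
by rewrite size_map -cardE mulnCA leq_mul2l leq_mul2r V_ltN orbT.
Qed.

Lemma call_diff A B :
  call f_diff [:: enc_set A; enc_set B] (enc_set (A :\: B)) (20 * (N * N)).
Proof.
apply: call_le.
  by apply: (@call_diff_row N); have := set_leN A; have := set_leN B;
    rewrite /enc_set; lia.
by rewrite -cardE mulnCA leq_mul2l leq_mul2r V_ltN orbT.
Qed.

Lemma call_compl A :
  call f_compl [:: enc_set A] (enc_set (~: A)) (20 * (N * N)).
Proof.
apply: call_le.
  by apply: (@call_compl_row N); have := set_leN A; rewrite /enc_set; lia.
by rewrite -cardE mulnCA leq_mul2l leq_mul2r V_ltN orbT.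
Qed.

Lemma enc_card_le A : tree_size (enc_nat #|A|) <= N.
Proof.
rewrite tree_size_nat; have := max_card A; have := size_enc_set A.
by have := set_leN A; lia.
Qed.

Lemma call_le_card A B :
  call f_le [:: enc_nat #|A|; enc_nat #|B|] (enc_bool (#|A| <= #|B|)) (20 * (N * N)).
Proof.
apply: call_le; first by apply: (@call_le_nat N); apply: enc_card_le.
rewrite mulnCA leq_mul2l leq_mul2r; have := max_card A; lia.
Qed.

(** * The algorithm on sets, and the cost of the program that computes it *)

Definition sets := seq {set V}.
Definition clauses := seq ({set V} * {set V}).
(** A candidate arc [(R, B :\: R, R')]: body, heads, and the root of the basin that is reached. *)
Definition cand := ({set V} * {set V} * {set V})%type.

Definition enc_cand (c : cand) : tree :=
  Node (enc_set c.1.1) (Node (enc_set c.1.2) (enc_set c.2)).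

Definition enc_option (b : option cand) : tree :=
  if b is Some c then enc_cand c else Leaf.

Definition enc_basins (rho : {set V} -> {set V}) (s : sets) : tree :=
  enc_seq (fun B => Node (enc_set B) (enc_set (rho B))) s.

(** [F] stands for the first member of the whole list and closes the cycle after the last one. *)
Fixpoint cyc (F : {set V}) (s : sets) : clauses :=
  if s is B :: s' then (B, head F s' :\: B) :: cyc F s' else [::].

Definition better (b : option cand) (c : cand) : option cand :=
  if b is Some b' then if #|b'.1.2| <= #|c.1.2| then b else Some c else Some c.

(** Roots belong to a Sperner family, where inclusion is equality: the test asks whether [B] lies in
    the basin of [R]. Inclusion is what [diff] and [ones] can decide. *)
Definition inner (rho : {set V} -> {set V}) R s b :=
  foldl (fun b B => if R \subset rho B then b else better b (R, B :\: R, rho B)) b s.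

Definition outer (rho : {set V} -> {set V}) l s b :=
  foldl (fun b B => inner rho (rho B) s b) b l.

Definition upd (rho : {set V} -> {set V}) R R' B :=
  if R \subset rho B then R' else rho B.

(* [k] is fuel: every round but the last merges two basins, so that [size s]
   rounds suffice. *)
Fixpoint loop k (s : sets) (rho : {set V} -> {set V}) : clauses :=
  if k is k'.+1 then
    if outer rho s s None is Some c
    then (c.1.1, c.1.2) :: loop k' s (upd rho c.1.1 c.2)
    else [:: (rho (head set0 s), ~: rho (head set0 s))]
  else [::].

Ltac set_sizes :=
  repeat match goal with
  | |- context [tree_size (enc_set ?A)] =>
    move: (tree_size (enc_set A)) (set_leN A) => ? ?
  end.

Lemma call_small (s : sets) : tree_size (enc_family s) <= N ->
  call f_small [:: enc_family s] (enc_bool (all (fun B : {set V} => #|B| <= 3) s))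
       ((size s).+1 * (50 * (N * N))).
Proof.
rewrite /enc_family; elim: s => [|B s IHs] /= leN.
  by ev_run fail; move: leN => /=; lia.
rewrite !enc_cons /= in leN *.
(* Three tails leave a [Node] exactly from cardinality 4 on. *)
have := call_ones_set B; case: #|B| => [|[|[|[|c]]]] H /=;
  ev_run (first [apply: IHs; lia | apply: H]); move: leN => /=; lia.
Qed.

Lemma call_cyc F (s : sets) : tree_size (enc_family s) <= N ->
  call f_cyc [:: enc_set F; enc_family s] (enc_cnf (cyc F s))
       ((size s).+1 * (50 * (N * N))).
Proof.
rewrite /enc_family /enc_cnf; elim: s => [|B s IHs] /= leN.
  by ev_run fail; move: leN (set_leN F) => /=; lia.
rewrite !enc_cons /= in leN *.
case: s IHs leN => [|B' s] IHs /= leN.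
  by ev_run (first [apply: IHs; rewrite /=; lia | apply: call_diff]);
    move: leN (set_leN F) => /=; lia.
rewrite !enc_cons /= in leN *.
by ev_run (first [apply: IHs; rewrite /=; lia | apply: call_diff]);
  move: leN (set_leN F) => /=; lia.
Qed.

Lemma call_init (s : sets) : tree_size (enc_family s) <= N ->
  call f_init [:: enc_family s] (enc_basins id s) ((size s).+1 * (20 * (N * N))).
Proof.
rewrite /enc_family /enc_basins; elim: s => [|B s IHs] /= leN.
  by ev_run fail; move: leN => /=; lia.
rewrite !enc_cons /= in leN *.
by ev_run (apply: IHs; lia); move: leN => /=; lia.
Qed.

Lemma call_better b c : call f_better [:: enc_option b; enc_cand c]
  (enc_option (better b c)) (90 * (N * N)).
Proof.
case: b => [b|]; rewrite /= /enc_cand; last first.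
  by ev_run fail; move=> /=; set_sizes; lia.
have le_card := call_le_card b.1.2 c.1.2.
case: (#|b.1.2| <= #|c.1.2|) le_card => /= le_card;
  ev_run (first [apply: le_card | apply: call_ones_set]); rewrite /=; set_sizes; lia.
Qed.

Lemma card_setD_eq0 A B : (#|A :\: B| == 0) = (A \subset B).
Proof. by rewrite cards_eq0 setD_eq0. Qed.

(** This is what the factor 5 in [set_leN] is for: a candidate is three encoded sets under two
    nodes. *)
Lemma option_leN b : tree_size (enc_option b) <= N.
Proof. by case: b => [c|] /=; set_sizes; lia. Qed.

Lemma call_inner rho R (s : sets) b : tree_size (enc_basins rho s) <= N ->
  call f_inner [:: enc_set R; enc_basins rho s; enc_option b]
       (enc_option (inner rho R s b)) ((size s).+1 * (200 * (N * N))).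
Proof.
rewrite /enc_basins; elim: s b => [|B s IHs] b /= leN.
  by ev_run fail; move: leN (option_leN b) => /=; lia.
rewrite !enc_cons /= in leN *.
have := call_ones_set (R :\: rho B); rewrite -card_setD_eq0.
have leNs : tree_size (enc_basins rho s) <= N by rewrite /enc_basins; lia.
case: #|R :\: rho B| => [|c] H /=.
  ev_run (first [apply: IHs | apply: H | apply: call_diff | done]).
  by move: leN (option_leN b) => /=; set_sizes; lia.
have Hb := call_better b (R, B :\: R, rho B).
ev_run (first [apply: IHs | apply: Hb | apply: H | apply: call_diff | done]).
by move: leN (option_leN b) => /=; set_sizes; lia.
Qed.

Let leN3 : N * N <= N * (N * N). Proof. by rewrite leq_pmull; lia. Qed.

Lemma call_outer rho (l s : sets) b :
  tree_size (enc_basins rho l) <= N -> tree_size (enc_basins rho s) <= N ->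
  call f_outer [:: enc_basins rho l; enc_basins rho s; enc_option b]
       (enc_option (outer rho l s b)) ((size l).+1 * (300 * (N * (N * N)))).
Proof.
(* A list is shorter than its encoding, so its length is absorbed into one more factor [N]. *)
move=> + leNs; have lt_sN : (size s).+1 * (200 * (N * N)) <= 200 * (N * (N * N)).
  rewrite mulnCA !leq_mul2l leq_mul2r; apply/orP; right; apply/orP; right.
  exact: leq_trans (size_enc_seq _ _) leNs.
rewrite {1 2}/enc_basins; elim: l b => [|B l IHl] b /= leN.
  by ev_run fail; move: leN (option_leN b) => /=; lia.
rewrite !enc_cons /= in leN *.
ev_run (first [apply: IHl; lia | apply: call_inner; lia]).
by move: leN (option_leN b) => /=; lia.
Qed.

Lemma call_upd rho R R' (s : sets) : tree_size (enc_basins rho s) <= N ->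
  call f_upd [:: enc_set R; enc_set R'; enc_basins rho s]
       (enc_basins (upd rho R R') s) ((size s).+1 * (100 * (N * N))).
Proof.
rewrite /enc_basins; elim: s => [|B s IHs] /= leN.
  by ev_run fail; move: leN => /=; lia.
rewrite !enc_cons /= in leN *.
have := call_ones_set (R :\: rho B); rewrite {1}/upd -card_setD_eq0.
case: #|R :\: rho B| => [|c] H /=.
  ev_run (first [apply: IHs; lia | apply: H | apply: call_diff]).
  by move: leN => /=; set_sizes; lia.
ev_run (first [apply: IHs; lia | apply: H | apply: call_diff]).
by move: leN => /=; set_sizes; lia.
Qed.

Let leN4 : N * (N * N) <= N * (N * (N * N)). Proof. by rewrite leq_pmull; lia. Qed.

(** The fuel [f] is separated from [s] for the induction, and the size bound is assumed for all
    [rho] because [rho] changes in every round. The last round reads the head of [s]. *)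
Lemma call_loop rho (s f : sets) :
  s != [::] -> (forall rho, tree_size (enc_basins rho s) <= N) ->
  tree_size (enc_family f) <= N ->
  call f_loop [:: enc_family f; enc_basins rho s]
       (enc_cnf (loop (size f) s rho)) ((size f).+1 * (600 * (N * (N * (N * N))))).
Proof.
move=> s_neq0 leNs.
have lt_sN c e : (size s).+1 * (c * e) <= c * (N * e).
  rewrite mulnCA leq_mul2l leq_mul2r; apply/orP; right; apply/orP; right.
  exact: leq_trans (size_enc_seq _ _) (leNs id).
rewrite /enc_family /enc_cnf; elim: f rho => [|F f IHf] rho /= leN.
  by ev_run fail; move: leN => /=; lia.
rewrite !enc_cons /= in leN *.
have lt1 := lt_sN 300 (N * (N * N)); have lt2 := lt_sN 100 (N * N).
have Ho := call_outer None (leNs rho) (leNs rho).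
case: (outer rho s s None) Ho => [c|] Ho.
  have Hu := call_upd c.1.1 c.2 (leNs rho).
  ev_run (first [apply: Ho | apply: Hu | apply: IHf; lia]).
  by move: leN (leNs rho) => /=; set_sizes; lia.
case: s s_neq0 leNs lt1 lt2 {lt_sN IHf} Ho => //= B s _ leNs lt1 lt2.
have := leNs rho; rewrite {2 3}/enc_basins !enc_cons /= => leN' Ho.
ev_run (first [apply: Ho | apply: call_compl]).
by move: leN leN' (leNs rho) => /=; set_sizes; lia.
Qed.

Let leN5 : N * (N * (N * N)) <= N * (N * (N * (N * N))).
Proof. by rewrite leq_pmull; lia. Qed.

Definition main (s : sets) : clauses :=
  if all (fun B : {set V} => #|B| <= 3) s then cyc (head set0 s) s
  else loop (size s) s id.

Lemma call_main (s : sets) :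
  (forall rho, tree_size (enc_basins rho s) <= N) -> tree_size (enc_family s) <= N ->
  call 0 [:: enc_family s] (enc_cnf (main s)) (900 * (N * (N * (N * (N * N))))).
Proof.
move=> leNs leN.
have lt_sN c e : (size s).+1 * (c * e) <= c * (N * e).
  rewrite mulnCA leq_mul2l leq_mul2r; apply/orP; right; apply/orP; right.
  exact: leq_trans (size_enc_seq _ _) leN.
have lt1 := lt_sN 50 (N * N); have lt2 := lt_sN 600 (N * (N * (N * N))).
have lt3 := lt_sN 20 (N * N).
have Hs := call_small leN; have Hi := call_init leN.
rewrite /main; case: ifP Hs => [_|all_s] Hs; last first.
  have Hl : _ := call_loop id _ leNs leN.
  case: s leNs leN lt1 lt2 lt3 all_s {lt_sN} Hs Hi Hl =>
    // B s leNs leN lt1 lt2 lt3 _ Hs Hi Hl.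
  ev_run (first [apply: Hs | apply: Hi | by apply: Hl]).
  by move: leN lt1 lt2 lt3 => /=; lia.
have Hc F := call_cyc F leN.
case: s leNs leN lt1 lt2 lt3 {lt_sN} Hs Hi Hc => [|B s] leNs leN lt1 lt2 lt3 Hs Hi Hc.
  (* For the empty family the first argument of [cyc] is [Leaf], which need not encode a set, so the
     call is executed directly. *)
  ev_run (first [apply: Hs | unfold call at 1]).
  by move: leN lt1 lt2 lt3 => /=; lia.
ev_run (first [apply: Hs | apply: (Hc B)]).
by move: leN lt1 lt2 lt3 => /=; lia.
Qed.
End Sets.

(** * Lower bounds for representations *)

Section Closed.
Variable V : finType.
Implicit Types (A B R X : {set V}) (Phi Psi : cnf V) (BB : {set {set V}}).

(** By [cnf_valP] these are the models of [Phi], read as sets of true variables; equivalence of CNFs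
    becomes equality of their closed sets. *)
Definition closed Phi X := forall c, c \in Phi -> c.1 \subset X -> c.2 \subset X.

Lemma cnf_valP Phi (x : assignment V) :
  reflect (closed Phi [set v | x v]) (cnf_val Phi x).
Proof.
apply: (iffP forall_inP) => [valP c cP c1x | clP c cP].
  apply/subsetP => v vc; rewrite inE.
  have /orP[//|/exists_inP[u uc]] := forall_inP (valP c cP) v vc.
  by have := subsetP c1x u uc; rewrite inE => ->.
apply/forall_inP => v vc; rewrite /horn_clause orbC -implyNb; apply/implyP.
rewrite negb_exists_in => /forall_inP c1x.
have /subsetP/(_ v vc) : c.2 \subset [set v | x v].
  by apply: clP => //; apply/subsetP => u /c1x; rewrite inE negbK.
by rewrite inE.
Qed.

Lemma key_closedP BB X :
  closed (key_cnf BB) X <-> forall B, B \in BB -> B \subset X -> X = [set: V].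
Proof.
split=> [clX B BBB BX | topX _ /imsetP[B BBB ->] /= /(topX _ BBB) ->];
  last exact: subsetT.
have /= CBX := clX _ (imset_f (fun B => (B, ~: B)) BBB) BX.
by apply/eqP; rewrite -subTset -(setUCr B) subUset BX.
Qed.

Lemma represents_closed Phi BB X : represents Phi BB ->
  closed Phi X <-> forall B, B \in BB -> B \subset X -> X = [set: V].
Proof.
case/andP=> _ /forallP/(_ [ffun v => v \in X])/eqP.
have eqX : [set v | [ffun v => v \in X] v] = X by apply/setP => v; rewrite inE ffunE.
have clP := cnf_valP _ [ffun v => v \in X]; rewrite eqX in clP.
rewrite -key_closedP /key_horn => eq_val.
by split=> /(introT (clP _)) val; apply/clP; move: val; rewrite eq_val.
Qed.

(** A clause with its body in [BB] follows from the key function, which forces all of [V] once the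
    body holds; the last hypothesis is the converse implication. *)
Lemma closed_represents Phi BB : pure_horn Phi ->
  (forall c, c \in Phi -> c.1 \in BB) ->
  (forall X B, closed Phi X -> B \in BB -> B \subset X -> X = [set: V]) ->
  represents Phi BB.
Proof.
move=> pure bodies topX; rewrite /represents pure; apply/forallP => x; apply/eqP.
apply/cnf_valP/cnf_valP => [clX | /key_closedP clX].
  by apply/key_closedP => B; apply: topX.
by move=> c cP /(clX _ (bodies c cP)) ->; apply: subsetT.
Qed.

Lemma size_BC_C Phi : size_BC Phi = size_C Phi + #|Phi|.
Proof.
rewrite /size_BC -sum1_card -big_split /=.
by apply: eq_bigr => c _; rewrite addn1.
Qed.

Section Representation.
Variables (BB : {set {set V}}) (Psi : cnf V).
Hypotheses (BB_proper : nonempty_proper BB) (BB_sperner : sperner BB).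
Hypothesis Psi_BB : represents Psi BB.

Lemma proper_neqT B : B \in BB -> B != [set: V].
Proof. by case/BB_proper => _; rewrite properT. Qed.

Lemma sperner_eq B B' : B \in BB -> B' \in BB -> B \subset B' -> B = B'.
Proof.
move=> BBB BBB'; rewrite subEproper => /orP[/eqP // |].
by rewrite (negbTE (BB_sperner BBB BBB')).
Qed.

(** Such an [X] is no model of the key function, hence none of [Psi]. The lower bounds below come
    from suitable choices of [X]. *)
Lemma violated_clause B X : B \in BB -> B \subset X -> X != [set: V] ->
  exists2 c, c \in Psi & (c.1 \subset X) && ~~ (c.2 \subset X).
Proof.
move=> BBB BX XT; apply/exists_inP/contraT => /exists_inPn noc.
have /(represents_closed _ Psi_BB)/(_ B BBB BX)/eqP : closed Psi X.
  by move=> c /noc + c1X; rewrite c1X negbK.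
by rewrite (negbTE XT).
Qed.

(** Otherwise the body would itself be a model, although it falsifies its own clause. *)
Lemma body_contains c : c \in Psi -> exists2 B, B \in BB & B \subset c.1.
Proof.
move=> cP; apply/exists_inP; apply/contraT => noB.
have /(represents_closed _ Psi_BB) clc :
    forall B, B \in BB -> B \subset c.1 -> c.1 = [set: V].
  by move=> B BBB Bc; case/exists_inP: noB; exists B.
have [/forall_inP/(_ c cP)/and3P[_ c2_neq0 c2C] _] := andP (proj1 (andP Psi_BB)).
move: c2_neq0; rewrite -subset0 -(setICr c.1) => /negP[].
by rewrite subsetI c2C clc.
Qed.

(** Take [X = B]: the falsified clause has its body inside [B], and this body contains a member,
    which is [B] by the Sperner property. *)
Lemma card_bodies : #|BB| <= #|Psi|.
Proof.
apply: leq_trans (leq_imset_card fst Psi); apply/subset_leq_card/subsetP => B BBB.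
have [c cP /andP[c1B _]] := violated_clause BBB (subxx B) (proper_neqT BBB).
have [B' BBB' B'c] := body_contains cP.
have B'E := sperner_eq BBB' BBB (subset_trans B'c c1B).
apply/imsetP; exists c => //; apply/eqP.
by rewrite eqEsubset c1B -{1}B'E B'c.
Qed.

(** Every variable [v] is a head: some member avoids [v], so [V] without [v] falsifies a clause, and
    only [v] can be the missing head. *)
Lemma card_vars : BB != set0 -> \bigcap_(B in BB) B = set0 -> #|V| <= size_C Psi.
Proof.
move=> BB_neq0 capBB; rewrite -cardsT.
have -> : [set: V] = \bigcup_(c in Psi) c.2.
  apply/esym/eqP; rewrite -subTset; apply/subsetP => v _.
  have /bigcapP : v \notin \bigcap_(B in BB) B by rewrite capBB inE.
  move=> notcap; have /exists_inP[B BBB vB] : [exists B in BB, v \notin B].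
    apply/contraT => /exists_inPn allB; case: notcap => B /allB; exact/negPn.
  have BX : B \subset ~: [set v] by rewrite subsetC sub1set inE.
  have [|c cP /andP[c1X /subsetPn[u uc]]] := violated_clause BBB BX.
    by apply/eqP => /setP/(_ v); rewrite !inE eqxx.
  by rewrite !inE negbK => /eqP uv; apply/bigcupP; exists c; rewrite -?uv.
rewrite /size_C; elim/big_rec2: _ => [|c k A _ le_kA]; first by rewrite cards0.
by rewrite (leq_trans (leq_card_setU _ _)) // leq_add2l.
Qed.

Section Exit.
Variables (rho : {set V} -> {set V}) (e : nat).
Let roots := rho @: BB.
Hypothesis rootP : {in BB, forall B, rho B \in BB /\ rho (rho B) = rho B}.
Hypothesis roots_gt1 : 1 < #|roots|.
Hypothesis leq_exit : forall R B,
  R \in roots -> B \in BB -> rho B != R -> e <= #|B :\: R|.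

Definition basin_clauses R :=
  [set c in Psi | [forall B in BB, (B \subset c.1) ==> (rho B == R)]].

(* Y consists of R and of all the heads of the clauses whose body contains
   only members of the basin of R; if Y contained no other member of BB, a
   clause falsified by Y would be one of these. *)
Lemma leq_basin R : R \in roots -> e <= \sum_(c in basin_clauses R) #|c.2|.
Proof.
move=> Rr; set Y := R :|: \bigcup_(c in basin_clauses R) c.2.
have [BR BRB eqR] := imsetP Rr; have [RBB rhoR] := rootP BRB.
rewrite -eqR in RBB rhoR.
have [B BBB /andP[BY neqR]] : exists2 B, B \in BB & (B \subset Y) && (rho B != R).
  apply/exists_inP; apply/contraT => /exists_inPn noB.
  have YT : Y != [set: V].
    (* If [Y] were [V], all members would have root [R] and there would be a single basin. *)
    apply/eqP => YT; move: roots_gt1; rewrite ltnNge => /negP[].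
    apply/card_le1_eqP => S S' /imsetP[B BBB ->] /imsetP[B' BBB' ->].
    have := noB B BBB; have := noB B' BBB'; rewrite YT !subsetT /= !negbK.
    by move=> /eqP-> /eqP->.
  have [c cP /andP[c1Y /negP[]]] := violated_clause RBB (subsetUl _ _) YT.
  apply: subset_trans (subsetUr _ _); apply: (bigcup_max c) => //.
  rewrite inE cP; apply/forall_inP => B BBB; apply/implyP => Bc.
  by have := noB B BBB; rewrite (subset_trans Bc c1Y) /= negbK.
apply: leq_trans (leq_exit Rr BBB neqR) _.
apply: (@leq_trans #|\bigcup_(c in basin_clauses R) c.2|).
  by apply/subset_leq_card; rewrite subDset.
elim/big_rec2: _ => [|c k A _ le_kA]; first by rewrite cards0.
by rewrite (leq_trans (leq_card_setU _ _)) // leq_add2l.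
Qed.

(** Each root accounts for [e] heads among its own clauses; a clause belongs to at most one root,
    since its body contains some member. *)
Lemma leq_roots_exit : #|roots| * e <= size_C Psi.
Proof.
rewrite -sum_nat_const.
apply: (@leq_trans (\sum_(R in roots) \sum_(c in basin_clauses R) #|c.2|)).
  by apply: leq_sum => R; apply: leq_basin.
rewrite (exchange_big_dep (mem Psi)) /=; last by move=> R c _; rewrite inE => /andP[].
apply: leq_sum => c cP; have [B BBB Bc] := body_contains cP.
rewrite sum_nat_cond_const -[leqRHS]mul1n leq_mul2r; apply/orP; right.
have root_c R : c \in basin_clauses R -> R = rho B.
  by rewrite inE cP => /forall_inP/(_ B BBB); rewrite Bc => /eqP.
apply/card_le1_eqP => R R'; rewrite [_ \in _]inE => /andP[_ /root_c->].
by rewrite inE => /andP[_ /root_c->].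
Qed.
End Exit.
End Representation.
End Closed.

(** * Approximation factor *)

Section Arithmetic.

(** The terms with [q >= m %/ 2] number [m - m %/ 2], and [q.+1] is at least this number, so
    together they are at most [O]. *)
Lemma halving_sum (O K m : nat) :
  \sum_(q < m) minn (O %/ q.+1) K <= O + \sum_(q < m %/ 2) minn (O %/ q.+1) K.
Proof.
rewrite -!(big_mkord xpredT (fun q => minn (O %/ q.+1) K)).
rewrite (big_cat_nat (leq0n _) (leq_div m 2)) [leqLHS]addnC leq_add2r /=.
case: (posnP (m - m %/ 2)) => [m0 | m_gt0]; first by rewrite big_geq //; lia.
apply: (@leq_trans (\sum_(m %/ 2 <= q < m) O %/ (m - m %/ 2))).
  rewrite big_nat [leqRHS]big_nat; apply: leq_sum => q /andP[lt_q _].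
  by rewrite (leq_trans (geq_minl _ _)) // leq_div2l //; lia.
by rewrite sum_nat_const_nat mulnC leq_trunc_div.
Qed.

Lemma halving_sums (O K m t : nat) :
  \sum_(q < m) minn (O %/ q.+1) K <= t * O + m %/ 2 ^ t * K.
Proof.
elim: t m => [|t IHt] m.
  rewrite mul0n add0n expn0 divn1.
  apply: (@leq_trans (\sum_(q < m) K)); last by rewrite sum_nat_const card_ord.
  by apply: leq_sum => q _; apply: geq_minr.
apply: leq_trans (halving_sum O K m) _; rewrite mulSn expnS divnMA -addnA.
by rewrite leq_add2l.
Qed.

(** With [a] terms left after the halvings, [a * n <= O]. The last root costs [n - K], which fits
    into the same [O] as the [a] terms of at most [K]: this saves one unit of the factor. *)
Lemma log_n_bound O K m n : m <= O -> n <= O -> K <= n -> 0 < n ->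
  \sum_(q < m) minn (O %/ q.+1) K + (n - K) <= (up_log 2 n + 1) * O.
Proof.
move=> leO leO' leK n_gt0; set t := up_log 2 n.
have := halving_sums O K m t; set a := m %/ 2 ^ t => le_sum.
have le_an : a * n <= O.
  apply: leq_trans leO; apply: leq_trans (leq_trunc_div m (2 ^ t)).
  by rewrite leq_mul2l up_logP // orbT.
suff : a * K + (n - K) <= O by rewrite mulnDl mul1n; lia.
case: a le_an {le_sum} => [|a] le_an; first by lia.
by have : a * K <= a * n by [rewrite leq_mul2l leK orbT]; lia.
Qed.

(** Here the remaining terms and the last root each get their own [O], whence the 2. *)
Lemma log_k_bound O K m n k : m <= O -> n <= O -> K <= k ->
  \sum_(q < m) minn (O %/ q.+1) K + (n - K) <= (up_log 2 k + 2) * O.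
Proof.
move=> leO leO' leK; set t := up_log 2 k.
have := halving_sums O K m t; set a := m %/ 2 ^ t => le_sum.
have le_aK : a * K <= O.
  apply: leq_trans leO; apply: leq_trans (leq_trunc_div m (2 ^ t)).
  by rewrite leq_mul2l (leq_trans leK) ?orbT // up_logP.
by rewrite mulnDl; lia.
Qed.

(** Beyond 3 the factor [k] is never the smallest. The claim amounts to [k <= 2 ^ (k - 2)]. *)
Lemma up_log_small k : 3 < k -> up_log 2 k + 2 <= k.
Proof.
case: k => [|[|k]] // k_gt1; rewrite addn2 !ltnS; apply: up_log_min => //.
elim: k k_gt1 => [|[|[|k]]] // IHk _.
by have := IHk isT; rewrite [2 ^ k.+3]expnS; lia.
Qed.

End Arithmetic.

(** * The arc chosen in one round *)

Section Best.
Variable V : finType.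
Implicit Types (A B R X : {set V}) (s : seq {set V}) (c : cand V).

Lemma foldl_better c l : exists c', [/\ foldl (@better V) (Some c) l = Some c',
  c' \in c :: l & forall d, d \in c :: l -> #|c'.1.2| <= #|d.1.2|].
Proof.
elim: l c => [|d l IHl] c.
  by exists c; split; rewrite ?mem_head // => d; rewrite inE => /eqP->.
rewrite /=; case: leqP => le_cd.
  have [c' [-> c'l min_c']] := IHl c; exists c'; split=> //.
    by move: c'l; rewrite !inE => /orP[->|->]; rewrite ?orbT.
  move=> x; rewrite inE => /orP[/eqP->|]; first exact/min_c'/mem_head.
  rewrite inE => /orP[/eqP->|xl]; last by apply: min_c'; rewrite inE xl orbT.
  exact: leq_trans (min_c' c (mem_head _ _)) le_cd.
have [c' [-> c'l min_c']] := IHl d; exists c'; split=> //.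
  by rewrite inE c'l orbT.
move=> x; rewrite inE => /orP[/eqP->|]; last exact: min_c'.
exact: leq_trans (min_c' d (mem_head _ _)) (ltnW le_cd).
Qed.

Variant best_spec (rho : {set V} -> {set V}) s : option (cand V) -> Prop :=
  | BestNone of (forall B B', B \in s -> B' \in s -> rho B \subset rho B') :
      best_spec rho s None
  | BestSome B B' of B \in s & B' \in s & ~~ (rho B \subset rho B')
      & (forall C C', C \in s -> C' \in s -> ~~ (rho C \subset rho C') ->
           #|B' :\: rho B| <= #|C' :\: rho C|) :
      best_spec rho s (Some (rho B, B' :\: rho B, rho B')).

(** The nested folds amount to a single fold of [better] over all arcs between different basins, to
    which [foldl_better] applies. *)
Lemma outerP rho s : best_spec rho s (outer rho s s None).
Proof.
pose cands R := [seq (R, B' :\: R, rho B') | B' <- s & ~~ (R \subset rho B')].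
have innerE R b : inner rho R s b = foldl (@better V) b (cands R).
  rewrite /inner /cands; elim: {cands}s b => //= B' s' IHs b.
  by case: (R \subset rho B') => /=; rewrite IHs.
have -> : outer rho s s None =
    foldl (@better V) None (flatten [seq cands (rho B) | B <- s]).
  rewrite /outer; elim: {2 3}s None => //= B l IHl b.
  by rewrite foldl_cat -innerE IHl.
have memP d : reflect (exists B B', [/\ B \in s, B' \in s,
      ~~ (rho B \subset rho B') & d = (rho B, B' :\: rho B, rho B')])
    (d \in flatten [seq cands (rho B) | B <- s]).
  apply: (iffP flatten_mapP) => [[B Bs /mapP[B' + ->]] | [B [B' [Bs B's nBB' ->]]]].
    by rewrite mem_filter => /andP[nBB' B's]; exists B, B'.
  by exists B => //; apply/mapP; exists B'; rewrite // mem_filter nBB'.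
case: (flatten _) memP => [|c l] memP.
  constructor=> B B' Bs B's; apply/negPn/negP => nBB'.
  have : (rho B, B' :\: rho B, rho B') \in [::] by apply/memP; exists B, B'.
  by rewrite in_nil.
rewrite [foldl _ _ _]/=.
have [c' [-> /memP[B [B' [Bs B's nBB' ->]]] min_c']] := foldl_better c l.
constructor=> // C C' Cs C's nCC'.
by apply: (min_c' (rho C, C' :\: rho C, rho C')); apply/memP; exists C, C'.
Qed.

End Best.

(** * Correctness and weight of both algorithms *)

Section Correctness.
Variables (V : finType) (BB : {set {set V}}) (s : seq {set V}).
Hypotheses (BB_proper : nonempty_proper BB) (BB_sperner : sperner BB).
Hypothesis cupBB : \bigcup_(B in BB) B = [set: V].
Hypothesis BB_neq0 : BB != set0.
Hypotheses (s_uniq : uniq s) (sBB : s =i BB).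
Implicit Types (A B R X : {set V}) (r : clauses V).

Definition weight r := \sum_(c <- r) #|c.2|.

(** The common guarantee of both algorithms. It makes [r] a representation, and the exact list of
    bodies settles the extra term of [size_BC]. *)
Definition good r :=
  [/\ uniq (unzip1 r), unzip1 r =i BB,
      forall c, c \in r -> (c.2 != set0) && (c.2 \subset ~: c.1)
    & forall X B, (forall c, c \in r -> c.1 \subset X -> c.2 \subset X) ->
        B \in BB -> B \subset X -> X = [set: V]].

Lemma setD_clause B B' : B \in BB -> B' \in BB -> B != B' ->
  (B' :\: B != set0) && (B' :\: B \subset ~: B).
Proof.
move=> BBB BBB' neqB; rewrite setDE subsetIr andbT -setDE setD_eq0.
by apply: contra neqB => /(sperner_eq BB_sperner BBB' BBB) ->.
Qed.

Section Loop.
(** [O] will be the size of an arbitrary representation, known only through the conclusion of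
    [leq_roots_exit]; [K] is the minimum size of a member. *)
Variables (O K : nat).
Hypothesis leq_K : forall B, B \in BB -> K <= #|B|.
Hypothesis ex_K : exists2 B, B \in BB & #|B| <= K.
Hypothesis leq_exit_O : forall (rho : {set V} -> {set V}) e,
  {in BB, forall B, rho B \in BB /\ rho (rho B) = rho B} ->
  1 < #|rho @: BB| ->
  (forall R B, R \in rho @: BB -> B \in BB -> rho B != R -> e <= #|B :\: R|) ->
  #|rho @: BB| * e <= O.

(** The invariant for the remaining rounds: they use each current root once as a body, and rely on
    the earlier clauses only for deriving from a member the root of its basin. *)
Lemma loop_spec k rho :
  {in BB, forall B, rho B \in BB /\ rho (rho B) = rho B} ->
  #|rho @: BB| <= k ->
  let r := loop k s rho in
  [/\ uniq (unzip1 r), unzip1 r =i rho @: BB,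
      forall c, c \in r -> (c.2 != set0) && (c.2 \subset ~: c.1),
      forall X B, (forall c, c \in r -> c.1 \subset X -> c.2 \subset X) ->
        (forall B, B \in BB -> B \subset X -> rho B \subset X) ->
        B \in BB -> B \subset X -> X = [set: V]
    & weight r <= \sum_(q < #|rho @: BB|) minn (O %/ q.+1) K + (#|V| - K)].
Proof.
have [B0 B0BB] := set0Pn _ BB_neq0.
elim: k rho => [|k IHk] rho rhoP.
  by rewrite leqn0 cards_eq0 imset_eq0 (negbTE BB_neq0).
move=> le_k; rewrite /=.
have rootE B B' : B \in BB -> B' \in BB -> (rho B \subset rho B') = (rho B == rho B').
  move=> /rhoP[BBB _] /rhoP[BBB' _]; apply/idP/eqP => [|->//].
  exact: (sperner_eq BB_sperner).
case: (outerP rho s) => [all_eq | B B' + + nBB' min_BB'].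
  set R := rho (head set0 s).
  have hs : head set0 s \in BB.
    by rewrite -sBB; case: s sBB => [/(_ B0)|*]; rewrite ?mem_head // B0BB.
  have rootR B : B \in BB -> rho B = R.
    by move=> BBB; apply/eqP; rewrite -rootE // all_eq ?sBB.
  have [RBB _] := rhoP _ hs.
  have roots1 : rho @: BB = [set R].
    apply/setP => X; rewrite inE; apply/imsetP/eqP => [[B /rootR-> //]|->].
    by exists (head set0 s).
  split=> //=.
  - by move=> X; rewrite inE roots1 inE.
  - move=> c; rewrite inE => /eqP->/=; rewrite subxx andbT.
    apply: contraNneq (proper_neqT BB_proper RBB) => C0.
    by apply/eqP/setC_inj; rewrite C0 setCT.
  - move=> X B clX rhoX BBB BX; apply/eqP; rewrite -subTset -(setUCr R) subUset.
    have RX : R \subset X by rewrite -(rootR B) // rhoX.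
    by rewrite RX (clX (R, ~: R)) ?mem_head.
  - rewrite /weight big_seq1 /= cardsCs setCK roots1.
    by rewrite (leq_trans _ (leq_addl _ _)) // leq_sub2l ?leq_K.
rewrite !sBB => BBB BBB' /=.
set R := rho B in nBB' min_BB' *; set R' := rho B' in nBB' *.
have [RBB rhoR] : R \in BB /\ rho R = R := rhoP _ BBB.
have [RBB' rhoR'] : R' \in BB /\ rho R' = R' := rhoP _ BBB'.
have neqR : R != R' by rewrite -rootE.
have updE C : C \in BB -> upd rho R R' C = if rho C == R then R' else rho C.
  by move=> CBB; rewrite /upd rootE // eq_sym.
have updP : {in BB, forall C,
    upd rho R R' C \in BB /\ upd rho R R' (upd rho R R' C) = upd rho R R' C}.
  move=> C CBB; have [rCBB rrC] := rhoP _ CBB; rewrite (updE C) //.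
  case: (rho C =P R) => [_ | /eqP neqC]; first by rewrite updE // rhoR' if_same.
  by rewrite updE // rrC (negbTE neqC).
have upd_roots : upd rho R R' @: BB = rho @: BB :\ R.
  apply/setP => X; rewrite !inE; apply/imsetP/andP
    => [[C CBB ->]|[neqX /imsetP[C CBB eqX]]].
    rewrite updE //; case: (rho C =P R) => [_ | /eqP neqC]; last by rewrite neqC imset_f.
    by rewrite eq_sym neqR imset_f.
  by exists C => //; rewrite updE // -eqX (negbTE neqX).
have Rroot : R \in rho @: BB by apply: imset_f.
have card_roots : #|rho @: BB| = #|upd rho R R' @: BB|.+1.
  by rewrite upd_roots (cardsD1 R) Rroot.
have roots_gt1 : 1 < #|rho @: BB|.
  rewrite card_roots ltnS card_gt0 upd_roots; apply/set0Pn; exists R'.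
  by rewrite !inE eq_sym neqR imset_f.
have [|uniq_r mem_r ok_r top_r weight_r] := IHk _ updP.
  by rewrite -ltnS -card_roots.
split=> /=.
- by rewrite uniq_r andbT mem_r upd_roots !inE eqxx.
- move=> X; rewrite inE mem_r upd_roots !inE.
  by case: eqP => // ->; rewrite Rroot.
- move=> c; rewrite inE => /orP[/eqP->|/ok_r //]; apply: setD_clause => //=.
  by apply: contraNneq nBB' => eqR; rewrite /R' -eqR rhoR.
- move=> X C clX rhoX CBB CX; apply: (top_r X C) => // [c cr|D DBB DX].
    by apply: clX; rewrite inE cr orbT.
  rewrite updE //; case: (rho D =P R) => [eqR|_]; last exact: rhoX.
  (* A member of the merged basin derives [R], then [B'] by the new clauses, then the root [R'] of
     [B']. *)
  have RX : R \subset X by rewrite -eqR rhoX.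
  apply: rhoX => //.
  have /= := clX _ (mem_head _ _) RX.
  by rewrite subDset => /subset_trans; apply; rewrite subUset RX subxx.
(* The arc of this round is paid by the last term of the sum, whose [q.+1] is the current number of
   basins. *)
rewrite /weight big_cons /= card_roots big_ord_recr /= -/(weight _).
rewrite [X in _ <= X + _]addnC -addnA leq_add // leq_min; apply/andP; split.
  rewrite leq_divRL // mulnC -card_roots; apply: leq_exit_O => //.
  move=> S C /imsetP[D DBB ->] CBB neqS.
  by apply: min_BB'; rewrite ?sBB // rootE // eq_sym.
(* With two basins left, a smallest member [C] is the target of an arc from another root, of length
   at most [#|C|]. *)
have [C CBB leCK] := ex_K; apply: leq_trans leCK.
have [D DBB neqD] : exists2 D, D \in BB & rho D != rho C.
  case: (eqVneq (rho C) R) => [->|neqC]; last by exists B; rewrite // eq_sym.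
  by exists B'; rewrite // eq_sym.
apply: leq_trans (min_BB' D C _ _ _) _; rewrite ?sBB // ?rootE //.
by apply: subset_leq_card; apply: subsetDl.
Qed.
End Loop.

(** A single member would be the whole union [V], hence not proper. *)
Lemma size_gt1 : 1 < size s.
Proof.
have [B BBB] := set0Pn _ BB_neq0.
have eq_size : size s = #|BB| by rewrite -(eq_card sBB) (card_uniqP s_uniq).
rewrite eq_size (cardD1 B) BBB ltnS lt0n; apply/negP => /eqP/card0_eq BB1.
have := proper_neqT BB_proper BBB; rewrite -cupBB (bigD1 B) //= big1 ?setU0 ?eqxx //.
by move=> B' /andP[BBB' neqB]; have := BB1 B'; rewrite !inE neqB BBB'.
Qed.

(** * The cyclic algorithm *)

Lemma cyc_bodies F (l : seq {set V}) : unzip1 (cyc F l) = l.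
Proof. by elim: l => //= B l ->. Qed.

Lemma cyc_clauses F (l : seq {set V}) c : uniq l -> F \notin l -> c \in cyc F l ->
  exists B B', [/\ B \in l, B' \in F :: l, B != B' & c = (B, B' :\: B)].
Proof.
elim: l => //= B l IHl /andP[Bl l_uniq]; rewrite inE negb_or => /andP[neqF Fl].
rewrite inE => /orP[/eqP-> | /IHl[] // C [C' [Cl C'l neqC ->]]]; last first.
  exists C, C'; split=> //; first by rewrite inE Cl orbT.
  by move: C'l; rewrite !inE => /orP[->|->]; rewrite ?orbT.
exists B, (head F l); split=> //; first exact: mem_head.
  by case: l {IHl l_uniq Bl Fl} => [|C l] /=; rewrite !inE eqxx ?orbT.
case: l Bl {IHl l_uniq Fl} => [_|C l] /=; first by rewrite eq_sym.
by rewrite inE negb_or => /andP[].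
Qed.

Section CycClosed.
Variables (F X : {set V}).

Lemma cyc_step B l : (forall c, c \in cyc F (B :: l) -> c.1 \subset X -> c.2 \subset X) ->
  (B \subset X -> head F l \subset X) /\
  (forall c, c \in cyc F l -> c.1 \subset X -> c.2 \subset X).
Proof.
move=> clX; split=> [BX|c cl]; last by apply: clX; rewrite inE cl orbT.
have := clX _ (mem_head _ _) BX.
by rewrite subDset => /subset_trans; apply; rewrite subUset BX subxx.
Qed.

Lemma cyc_all l : (forall c, c \in cyc F l -> c.1 \subset X -> c.2 \subset X) ->
  head F l \subset X -> forall B, B \in F :: l -> B \subset X.
Proof.
elim: l => [|C l IHl] clX hX B; first by rewrite inE => /eqP->.
have [stepX {}/IHl IHl] := cyc_step clX; have {}IHl := IHl (stepX hX).
rewrite !inE orbCA => /predU1P[-> //|Bl]; apply: IHl.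
by rewrite inE.
Qed.

(** The cycle leads from any member on to [F], and from there [cyc_all] derives every member, hence
    their union [V]. *)
Lemma cyc_last l : (forall c, c \in cyc F l -> c.1 \subset X -> c.2 \subset X) ->
  forall B, B \in l -> B \subset X -> F \subset X.
Proof.
elim: l => // C l IHl clX B Bl BX.
have [eqB|neqB] := eqVneq B C.
  by apply: (cyc_all clX); rewrite ?mem_head //= -eqB.
have [_ {}/IHl IHl] := cyc_step clX.
by apply: IHl BX; move: Bl; rewrite inE (negbTE neqB).
Qed.

End CycClosed.

Lemma good_cyc : good (cyc (head set0 s) s).
Proof.
have := size_gt1; case: s s_uniq sBB => // F [|B l] //.
rewrite /= inE negb_or => /andP[/andP[neqF Fl] /andP[Bl l_uniq]] memBB _.
have clauseP c : c \in cyc F (F :: B :: l) ->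
  exists C C', [/\ C \in BB, C' \in BB, C != C' & c = (C, C' :\: C)].
  rewrite inE => /predU1P[->|cl].
    by exists F, B; rewrite -!memBB !inE !eqxx orbT.
  have [||C [C' [CBB C'BB neqC ->]]] := @cyc_clauses F (B :: l) c _ _ cl.
  - by rewrite /= Bl.
  - by rewrite inE negb_or neqF.
  by exists C, C'; rewrite -!memBB; split; rewrite // inE CBB orbT.
split.
- by rewrite (cyc_bodies F [:: F, B & l]) /= inE negb_or neqF Fl Bl.
- by rewrite (cyc_bodies F [:: F, B & l]).
- by move=> c /clauseP[C [C' [CBB C'BB neqC ->]]]; apply: setD_clause.
move=> X C clX CBB CX.
have FX : F \subset X.
  by apply: (@cyc_last F X [:: F, B & l] clX C) CX; rewrite memBB.
apply/eqP; rewrite -subTset -cupBB; apply/bigcupsP => D DBB.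
by apply: (@cyc_all F X [:: F, B & l] clX) => //; rewrite inE memBB DBB orbT.
Qed.

Lemma weight_cyc k F (l : seq {set V}) : (forall B, B \in F :: l -> #|B| <= k) ->
  weight (cyc F l) <= k * size l.
Proof.
elim: l => [|B l IHl] le_k; first by rewrite /weight big_nil.
rewrite /weight big_cons mulnS leq_add //=; last first.
  apply: IHl => C; rewrite inE => /predU1P[->|Cl]; apply: le_k; rewrite ?mem_head //.
  by rewrite !inE Cl !orbT.
apply: leq_trans (subset_leq_card (subsetDl _ _)) _; apply: le_k.
by case: l {IHl} => [|C l]; rewrite !inE eqxx ?orbT.
Qed.

(** * From clause lists to representations and their sizes *)

Lemma good_pure r : good r -> pure_horn [set c | c \in r].
Proof.
case=> r_uniq memr okr _; apply/andP; split.
  apply/forall_inP => c; rewrite inE => cr; rewrite okr // andbT.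
  by case: (BB_proper (B := c.1)) => //; rewrite -memr map_f.
apply/forall_inP => c cr; apply/forall_inP => c' c'r; apply/implyP => /eqP eqc.
rewrite !inE in cr c'r; apply/eqP.
elim: r r_uniq cr c'r {memr okr} => //= d r IHr /andP[d_r r_uniq].
rewrite !inE => /predU1P[eqd|cr] /predU1P[eqd'|c'r]; last exact: IHr.
- by rewrite eqd eqd'.
- by case/negP: d_r; rewrite -eqd eqc map_f.
- by case/negP: d_r; rewrite -eqd' -eqc map_f.
Qed.

Lemma good_represents r : good r -> represents [set c | c \in r] BB.
Proof.
move=> good_r; have [_ memr _ topr] := good_r.
apply: closed_represents; first exact: good_pure.
  by move=> c; rewrite inE -memr => /(map_f fst).
by move=> X B clX; apply: topr => c cr; apply: clX; rewrite inE.
Qed.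

Lemma good_uniq r : good r -> uniq r.
Proof. by case=> /map_uniq. Qed.

Lemma good_size_C r : good r -> size_C [set c | c \in r] = weight r.
Proof.
move=> /good_uniq r_uniq; rewrite /size_C /weight [RHS]big_uniq //=.
by apply: eq_bigl => c; rewrite inE.
Qed.

Lemma good_card r : good r -> #|[set c | c \in r]| = #|BB|.
Proof.
case=> r_uniq memr _ _; rewrite -(eq_card memr) (card_uniqP r_uniq) size_map.
by rewrite cardsE (card_uniqP (map_uniq r_uniq)).
Qed.

(** The exit bound when each member is its own basin: distinct members of a Sperner family are at
    distance at least 1. *)
Lemma leq_card_size_C Psi : represents Psi BB -> #|BB| <= size_C Psi.
Proof.
move=> PsiBB; have := @leq_roots_exit _ _ _ PsiBB id 1.
rewrite imset_id muln1; apply=> // [|R B RBB BBB neqR].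
  by rewrite -(eq_card sBB) (card_uniqP s_uniq) size_gt1.
by rewrite card_gt0; have /andP[] := setD_clause RBB BBB (contra_neq esym neqR).
Qed.

Lemma loop_bound Psi : represents Psi BB ->
  exists K, [/\ exists2 B, B \in BB & K = #|B|, good (loop (size s) s id)
    & weight (loop (size s) s id) <=
      \sum_(q < #|BB|) minn (size_C Psi %/ q.+1) K + (#|V| - K)].
Proof.
move=> PsiBB; have [B0 B0BB] := set0Pn _ BB_neq0.
have [B BBB leq_K] := arg_minnP (fun B : {set V} => #|B|) B0BB.
exists #|B|.
have [||||uniq_r mem_r ok_r top_r] :=
  @loop_spec (size_C Psi) #|B| leq_K _ _ (size s) id.
- by exists B.
- move=> rho e; exact: leq_roots_exit.
- by [].
- by rewrite imset_id -(eq_card sBB) (card_uniqP s_uniq).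
rewrite imset_id in mem_r * => weight_r; split=> //; first by exists B.
split=> // X C clX; apply: top_r => //.
Qed.

Lemma good_main : good (main s).
Proof.
rewrite /main; case: ifP => _; first exact: good_cyc.
(* [loop_bound] compares with some representation; for [good] any one serves. *)
by have [K []] := loop_bound (key_cnf_represents BB_proper).
Qed.

Lemma weight_main k Psi : represents Psi BB -> \bigcap_(B in BB) B = set0 ->
  (forall B, B \in BB -> #|B| <= k) ->
  weight (main s) <=
  minn (minn (up_log 2 #|V| + 1) (up_log 2 k + 2)) k * size_C Psi.
Proof.
move=> PsiBB capBB le_k; have leO := leq_card_size_C PsiBB.
have ltV B : B \in BB -> #|B| < #|V|.
  by case/BB_proper => _ /proper_card; rewrite cardsT.
have [B0 B0BB] := set0Pn _ BB_neq0.
rewrite /main; case: ifP => [/allP le3 | /allPn[B]]; last first.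
  rewrite sBB -ltnNge => BBB B_gt3.
  have [K [[C CBB eqK] _ le_w]] := loop_bound PsiBB.
  have leO' := card_vars PsiBB BB_neq0 capBB.
  have k_gt3 := leq_trans B_gt3 (le_k _ BBB); have small := up_log_small k_gt3.
  have le_Kk : K <= k by rewrite eqK le_k.
  have le_Kn : K <= #|V| by rewrite eqK ltnW ?ltV.
  have V_gt0 : 0 < #|V| := leq_ltn_trans (leq0n _) (ltV _ CBB).
  (* A member with more than 3 elements gives [k > 3], so [k] drops out of the minimum. *)
  rewrite [X in X * _](minn_idPl _); last by rewrite (leq_trans (geq_minr _ _)).
  rewrite minnMl leq_min (leq_trans le_w) ?(leq_trans le_w) //.
    exact: log_k_bound.
  exact: log_n_bound.
(* [k] itself may exceed 3, so the cycle is charged [km] per member. The facts [km <= 3], [km <= k]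
   and [km < #|V|] put [km] below all three factors. *)
set km := \max_(B in BB) #|B|.
have le_km B : B \in BB -> #|B| <= km.
  by move=> BBB; apply: (leq_bigmax_cond (F := fun B : {set V} => #|B|)).
have km3 : km <= 3 by apply/bigmax_leqP => B; rewrite -sBB; apply: le3.
have kmk : km <= k by apply/bigmax_leqP.
have BB_gt0 : 0 < #|BB| by rewrite card_gt0.
have kmV : km < #|V|.
  have [B BBB] := eq_bigmax_cond (fun B : {set V} => #|B|) BB_gt0.
  by rewrite -/km => ->; apply: ltV.
have hsBB B : B \in head set0 s :: s -> B \in BB.
  rewrite -sBB; case: s size_gt1 => // F l _.
  by rewrite inE => /predU1P[->|//]; rewrite mem_head.
apply: leq_trans (weight_cyc (k := km) _) _ => [B /hsBB /le_km //|].
have -> : size s = #|BB| by rewrite -(eq_card sBB) (card_uniqP s_uniq).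
apply: leq_mul => //; rewrite !leq_min kmk andbT.
have := leq_up_log 2 kmV; have := leq_up_log 2 kmk.
have up_log2 : up_log 2 2 = 1 by [].
have up_log3 : up_log 2 3 = 2 by [].
have up_log4 : up_log 2 4 = 2 by [].
by case: (km) km3 => [|[|[|[|]]]] // _; rewrite ?up_log2 ?up_log3 ?up_log4; lia.
Qed.

(** The weight is compared with every representation, since the two measures may attain their minima
    at different ones. *)
Lemma good_bounds r rho : good r -> 0 < rho ->
  (forall Psi, represents Psi BB -> weight r <= rho * size_C Psi) ->
  size_C [set c | c \in r] <= rho * OPT (@size_C V) BB /\
  size_BC [set c | c \in r] <= rho * OPT (@size_BC V) BB.
Proof.
move=> good_r rho_gt0 le_r; split.
  have [Psi PsiBB <-] := OPT_attained (@size_C V) BB_proper.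
  by rewrite good_size_C // le_r.
have [Psi PsiBB <-] := OPT_attained (@size_BC V) BB_proper.
rewrite !size_BC_C good_size_C // good_card // mulnDr leq_add ?le_r //.
apply: leq_trans (card_bodies BB_proper BB_sperner PsiBB) _.
by rewrite leq_pmull.
Qed.

End Correctness.

(** * Total running time and conclusion *)

Lemma enc_basins_le (V : finType) (s : seq {set V}) rho :
  tree_size (enc_basins rho s) <= 20 * tree_size (enc_family s).
Proof.
rewrite /enc_basins /enc_family; elim: s => //= B s IHs.
by have := enc_set_le (rho B); have := size_enc_set B; lia.
Qed.

(** An encoded set has size at most [4 * #|V| + 1] and a nonempty family more than [#|V|]; with the
    factor 5 of [set_leN] this gives 20. *)
Lemma enc_set_le_family (V : finType) (s : seq {set V}) (A : {set V}) :
  (s = [::] -> #|V| = 0) ->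
  5 * tree_size (enc_set A) <= 20 * tree_size (enc_family s).
Proof.
rewrite /enc_family; case: s => [/(_ erefl) V0|B s _] /=.
  by have := enc_set_le A; lia.
by have := enc_set_le A; have := size_enc_set B; lia.
Qed.

Lemma main_run (V : finType) (s : seq {set V}) :
  (s = [::] -> #|V| = 0) ->
  exists2 t, run prog (enc_family s) (enc_cnf (main s)) t
    & t <= 900 * 20 ^ 5 * tree_size (enc_family s) ^ 5.
Proof.
move=> V0; set S := tree_size _; have pow5 c : 900 * c ^ 5 * S ^ 5 =
    900 * (c * S * (c * S * (c * S * (c * S * (c * S))))).
  by rewrite -mulnA -expnMn !expnS expn0 muln1.
rewrite pow5; apply: call_main; last by rewrite -/S; lia.
- by move=> A; apply: enc_set_le_family.
- exact: enc_basins_le.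
Qed.

Theorem theorem2 :
  exists (P : program) (a d : nat),
  forall (V : finType) (n : nat) (BB : {set {set V}}) (s : seq {set V}) (k : nat),
    #|V| = n ->
    nonempty_proper BB ->
    sperner BB ->
    \bigcup_(B in BB) B = [set: V] ->
    \bigcap_(B in BB) B = set0 ->
    (forall B, B \in BB -> #|B| <= k) ->
    uniq s -> s =i BB ->
    exists (Phi : cnf V) (r : seq ({set V} * {set V})) (t : nat),
      [/\ run P (enc_family s) (enc_cnf r) t,
          t <= a * tree_size (enc_family s) ^ d,
          uniq r /\ r =i Phi,
          represents Phi BB
        & let rho := minn (minn (up_log 2 n + 1) (up_log 2 k + 2)) k in
          size_C Phi <= rho * OPT (@size_C V) BB /\
          size_BC Phi <= rho * OPT (@size_BC V) BB].
Proof.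
exists prog, (900 * 20 ^ 5), 5.
move=> V _ BB s k <- BB_proper BB_sperner cupBB capBB le_k s_uniq sBB.
have [t run_t le_t] : exists2 t, run prog (enc_family s) (enc_cnf (main s)) t
    & t <= 900 * 20 ^ 5 * tree_size (enc_family s) ^ 5.
  apply: main_run => s0; rewrite -cardsT -cupBB big_pred0 ?cards0 // => B.
  by rewrite -sBB s0.
exists [set c | c \in main s], (main s), t.
have memr : main s =i [set c | c \in main s] by move=> c; rewrite inE.
(* The empty family is possible when [V] is empty; the output is then the empty CNF. *)
have [BB0|BB_neq0] := eqVneq BB set0.
  have r0 : main s = [::].
    by case: s sBB {s_uniq run_t le_t memr} => // B s /(_ B); rewrite BB0 mem_head inE.
  have Phi0 : [set c | c \in main s] = set0 by apply/setP => c; rewrite r0 !inE.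
  split=> //; first by split; rewrite // r0.
    rewrite Phi0; apply: closed_represents => [|c|X B _]; rewrite ?BB0 ?inE //.
    by apply/andP; split; apply/forall_inP => c; rewrite inE.
  by rewrite Phi0 /size_C /size_BC !big_set0.
have good_r := good_main BB_proper BB_sperner cupBB BB_neq0 s_uniq sBB.
have [B BBB] := set0Pn _ BB_neq0; have B_neq0 := proj1 (BB_proper _ BBB).
split=> //; first by split=> //; exact: good_uniq good_r.
  exact: good_represents.
apply: (good_bounds BB_proper BB_sperner) => //; last first.
  by move=> Psi PsiBB; apply: (@weight_main _ BB).
(* The factor is positive because [k] bounds the size of a nonempty member. *)
rewrite !leq_min addn1 addn2 /=; apply: leq_trans (le_k B BBB).
by rewrite card_gt0.
Qed.
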